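(* For the Grassmann code $C(2,5)$ over $F_q$ we have $$d_5=n-(q^3+2q^2+q+1)=d_4+q^4=d_6-q^2.$$
   Context: $G(2,5)$ is the Grassmann variety of $2$-dimensional subspaces of a $5$-dimensional vector space over $F_q$, embedded in $\mathbf P^9$ by Plücker coordinates; $n=q^6+q^5+2q^4+2q^3+2q^2+q+1$ is its number of $F_q$-rational points. The Grassmann code $C(2,5)$ is the linear $[n,10]$-code over $F_q$ (up to equivalence) having as generator matrix a $10\times n$ matrix whose columns are representatives in $(F_q)^{10}$ of the $n$ points of $G(2,5)$. For $r=1,\dots,10$, $d_r$ is the $r$-th higher weight: the minimum cardinality of the support of an $r$-dimensional subcode (the support being the set of coordinate positions where some codeword of the subcode is nonzero). Equivalently $d_r=n-H_r$, where $H_r$ is the maximum number of $F_q$-points of $G(2,5)$ contained in a codimension $r$ linear subspace of $\mathbf P^9$. *)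

(* Defs.v *)
From mathcomp Require Import all_boot all_order all_algebra.
Set Implicit Arguments.
Unset Strict Implicit.
Unset Printing Implicit Defensive.
Import GRing.Theory.
Local Open Scope ring_scope.

(* The pairs i < j in lexicographic order; numerals denote elements of 'I_5. *)
Definition plucker_index : 10.-tuple ('I_5 * 'I_5) :=
  [tuple (0, 1); (0, 2); (0, 3); (0, 4); (1, 2);
         (1, 3); (1, 4); (2, 3); (2, 4); (3, 4)].

(* The maximal minors of a 2 x 5 matrix, whose rows are meant to be a basis of
   a 2-dimensional subspace of F^5. *)
Definition plucker (F : fieldType) (A : 'M[F]_(2, 5)) : 'cV[F]_10 :=
  \col_k let: (i, j) := tnth plucker_index k in
         A 0 i * A 1 j - A 0 j * A 1 i.

Definition same_proj_point (F : fieldType) (m : nat) (u v : 'cV[F]_m) : Prop :=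
  exists2 c : F, c != 0 & u = c *: v.

(* The columns of G are representatives of the points of G(2,5), each point
   being represented by exactly one column; hence n is the number of points.
   The order of the points and the representatives are arbitrary, which is the
   ambiguity "up to equivalence" in the Grassmann code. *)
Definition grassmann_generator (F : finFieldType) (n : nat)
    (G : 'M[F]_(10, n)) : Prop :=
  (forall j, exists2 A : 'M[F]_(2, 5),
     row_free A & same_proj_point (col j G) (plucker A)) /\
  (forall A : 'M[F]_(2, 5), row_free A ->
     exists! j, same_proj_point (col j G) (plucker A)).

(* Codes are row spaces of matrices. *)
Definition code_support (F : finFieldType) (m n : nat) (D : 'M[F]_(m, n)) :
    {set 'I_n} :=
  [set j | [exists v : 'rV[F]_n, (v <= D)%MS && (v 0 j != 0)]].

(* The default value n of the minimum is harmless when r <= \rank C, since no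
   support has more than n elements. *)
Definition higher_weight (F : finFieldType) (m n : nat) (C : 'M[F]_(m, n))
    (r : nat) : nat :=
  \big[minn/n]_(D : 'M[F]_n | (D <= C)%MS && (\rank D == r)) #|code_support D|.

(* Main.v *)
Require Import Defs.
From HB Require Import structures.
From mathcomp Require Import all_boot all_order all_algebra.
From mathcomp Require Import mxabelem.
From mathcomp Require Import zify ring.

(** Read through the columns of the generator matrix, d_r is n minus the largest
number of points of G(2,5) in a linear subspace of rank 10 - r of the space of
bivectors, so everything reduces to counting decomposable bivectors u /\ v in
a subspace W of rank 6, 5 or 4.

In rank 4 all q^4 vectors of W may be decomposable: take the pencil v /\ V of
all lines through a point v.

In rank k + 1 with k = 4 or 5 there are at most q^k + q^3 - q^2 decomposable
vectors in W, zero included ([card_decomposables_bound]).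
If W contains a pencil v /\ V, each other coset of v /\ V inside W
holds at most q^2 decomposable vectors, since two of them, a /\ b and
a /\ b + v /\ x, force x to lie in the plane spanned by a, b and v
([card_decomposables_pencil]).  Otherwise fix a line p = u /\ w in W
([card_decomposables_line]).  A decomposable vector of W either meets the line
p, and then lies in the pencil of one of the q + 1 points of p, or is skew to
it.  Adding a nonzero multiple of p to a skew line yields an indecomposable
bivector, so the skew lines lie in distinct cosets of <p>, and these cosets are
outside the tangent space T = u /\ V + w /\ V.  As for the lines
meeting p, the parts of W in the pencils at two points of p meet in <p> only,
which limits the sum of their ranks by the rank of T :&: W + 1; each of these
ranks is at most 3.  The two estimates add up to the bound.

The bound is attained in rank 5 by a pencil v /\ V together with a line not
through v ([card_decomposables_rank5]), and in rank 6 by the bivectors of a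
hyperplane of V, whose decomposable elements form the cone over a Klein quadric
([card_decomposables_rank6]).  The same incidence count as for the hyperplane
([card_wedges]), applied to V itself, gives the value of n. *)

Set Implicit Arguments.
Unset Strict Implicit.
Unset Printing Implicit Defensive.
Import GRing.Theory.
Local Open Scope ring_scope.

(** * Counting and linear algebra *)

Lemma exp4_sub1 n : (n ^ 4 - 1 = (n ^ 2 + 1) * (n ^ 2 - 1))%N.
Proof.
by rewrite (expnM _ 2 2) -[X in (_ - X = _)%N](exp1n 2) subn_sqr mulnC.
Qed.

Lemma double_count (T U : finType) (A : {set T}) (B : {set U})
    (R : T -> U -> bool) :
  (\sum_(x in A) #|[set y in B | R x y]| =
   \sum_(y in B) #|[set x in A | R x y]|)%N.
Proof.
rewrite (eq_bigr (fun x => \sum_(y in B | R x y) 1)%N); last first.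
  by move=> x _; rewrite -sum1dep_card.
rewrite [RHS](eq_bigr (fun y => \sum_(x in A | R x y) 1)%N); last first.
  by move=> y _; rewrite -sum1dep_card.
rewrite (exchange_big_dep (mem B)) /= => [|x y _ /andP[]//].
by apply: eq_bigr => y yB; apply: eq_bigl => x; rewrite yB.
Qed.

Lemma double_count_const (T U : finType) (A : {set T}) (B : {set U})
    (R : T -> U -> bool) r c :
    (forall x, x \in A -> #|[set y in B | R x y]| = r) ->
    (forall y, y \in B -> #|[set x in A | R x y]| = c) ->
  (#|A| * r = #|B| * c)%N.
Proof.
by move=> Hr Hc; rewrite -!sum_nat_const -(eq_bigr _ Hr) -(eq_bigr _ Hc)
  double_count.
Qed.

Lemma leq_card_fibre (T U : finType) (S : {set T}) (B : {set U})
    (f : T -> U) c :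
    (forall x, x \in S -> f x \in B) ->
    (forall y, #|[set x in S | f x == y]| <= c)%N -> (#|S| <= #|B| * c)%N.
Proof.
move=> fB fc; rewrite -sum1_card -sum_nat_const.
rewrite (partition_big f (mem B)) //; apply: leq_sum => y _.
by rewrite sum1dep_card; apply: leq_trans (fc y); apply: subset_leq_card;
  apply/subsetP => x; rewrite !inE.
Qed.

Lemma leq_card_bigcup (I T : finType) (A : I -> {set T}) :
  (#|\bigcup_i A i| <= \sum_i #|A i|)%N.
Proof.
elim/big_rec2: _ => [|i n B _ le]; first by rewrite cards0.
by apply: leq_trans (leq_card_setU _ _) _; rewrite leq_add2l.
Qed.

Lemma adds_not_sub (F : fieldType) m n (A : 'M[F]_(m, n)) (x : 'rV[F]_n) :
  ~~ (x <= A)%MS -> \rank (A + x)%MS = (\rank A).+1.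
Proof.
move=> nx; have x1 : \rank x = 1%N.
  by rewrite rank_rV; case: eqP nx => // ->; rewrite sub0mx.
have := mxrank_sum_cap A x.
suff -> : (A :&: x)%MS = 0 by rewrite mxrank0 x1 addn0 addn1.
apply/eqP; rewrite -mxrank_eq0; apply: contraNT nx => r0.
have [r1 r2] := mxrank_leqif_eq (capmxSr A x).
move: r1 r2; rewrite x1 leq_eqVlt ltnS leqn0 (negPf r0) orbF => ->
  /esym/eqmxP e.
by rewrite -e capmxSl.
Qed.

(** A form pulled back along independent vectors keeps its rank; used with J the
standard symplectic matrix of size 2 or 4. *)
Lemma rank_congr (F : fieldType) m n (M : 'M[F]_(m, n)) (J : 'M[F]_m) :
  row_free M -> \rank (M^T *m J *m M) = \rank J.
Proof.
move=> fM; rewrite mxrankMfree // -mxrank_tr trmx_mul trmxK mxrankMfree //.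
by rewrite mxrank_tr.
Qed.

Lemma sub_copid (F : fieldType) n r (y : 'rV[F]_n) : (r <= n)%N ->
  (y <= copid_mx r)%MS = [forall k : 'I_n, (k < r)%N ==> (y 0 k == 0)].
Proof.
move=> rn; have yE (z : 'rV[F]_n) k : (z *m (pid_mx r : 'M_n)) 0 k =
  if (k < r)%N then z 0 k else 0.
  rewrite mxE (bigD1 k) //= big1 ?addr0 => [|i ik].
    by rewrite mxE eqxx /=; case: ifP => _; rewrite ?mulr1 ?mulr0.
  have /negPf e : (i != k :> nat) by [].
  by rewrite mxE e mulr0.
have -> : (y <= copid_mx r)%MS = (y *m (pid_mx r : 'M_n) == 0).
  apply/idP/eqP => [/submxP[z ->]|y0].
    by rewrite -mulmxA mul_copid_mx_pid ?mulmx0.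
  by rewrite -[y]mulmx1 -(subrK (pid_mx r) 1%:M) mulmxDr y0 addr0 submxMl.
apply/eqP/forallP => [y0 k|y0].
  by apply/implyP => kr; have := yE y k; rewrite y0 kr mxE => <-.
by apply/rowP => k; rewrite yE [RHS]mxE; case: ifP => // kr;
  apply/eqP/(implyP (y0 k)).
Qed.

Lemma col_mulmx (R : nzRingType) m n p (j : 'I_p)
    (A : 'M[R]_(m, n)) (B : 'M[R]_(n, p)) :
  col j (A *m B) = A *m col j B.
Proof. by rewrite !colE mulmxA. Qed.

(** * Decomposable bivectors and pencils of lines *)

Section Wedge.
Variable F : fieldType.
Implicit Types a b c d e f u v w x : 'rV[F]_5.

(** The wedge product in Pluecker coordinates: the bivector of the line joining
the projective points u and v. *)
Definition wedge u v : 'rV[F]_10 :=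
  \row_k let: (i, j) := tnth plucker_index k in u 0 i * v 0 j - u 0 j * v 0 i.

Lemma wedge_is_linear u : linear (wedge u).
Proof.
move=> s v w; apply/rowP => k; rewrite !mxE.
by case: (tnth _ k) => i j; rewrite !mxE; ring.
Qed.

HB.instance Definition _ u :=
  GRing.isLinear.Build F _ _ _ (wedge u) (wedge_is_linear u).

Lemma wedgeC u v : wedge u v = - wedge v u.
Proof. by apply/rowP => k; rewrite !mxE; case: (tnth _ k) => i j; ring. Qed.

Lemma wedgevv v : wedge v v = 0.
Proof. by apply/rowP => k; rewrite !mxE; case: (tnth _ k) => i j; ring. Qed.

Lemma wedgeDl u v w : wedge (u + v) w = wedge u w + wedge v w.
Proof. by rewrite wedgeC linearD opprD -!wedgeC. Qed.

Lemma wedgeZl s u v : wedge (s *: u) v = s *: wedge u v.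
Proof. by rewrite wedgeC linearZ /= -scalerN -wedgeC. Qed.

(** The row space of [pencil v] is v /\ V; its nonzero vectors are the lines
through the point v. *)
Definition pencil v : 'M[F]_(5, 10) := lin1_mx (wedge v).

Lemma mul_pencil v x : x *m pencil v = wedge v x.
Proof. exact: mul_rV_lin1. Qed.

Lemma pencilP y v : reflect (exists x, y = wedge v x) (y <= pencil v)%MS.
Proof.
apply: (iffP submxP) => [[x ->]|[x ->]]; exists x; by rewrite mul_pencil.
Qed.

Lemma wedge_pencil v x : (wedge v x <= pencil v)%MS.
Proof. by apply/pencilP; exists x. Qed.

(** The alternating matrix of u /\ v.  Unlike the coordinate vector [wedge u v],
it has a rank and a row space, which detect decomposability and recover the
line. *)
Definition altmx u v : 'M[F]_5 := u^T *m v - v^T *m u.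

Lemma altmxE u v i j : altmx u v i j = u 0 i * v 0 j - u 0 j * v 0 i.
Proof. by rewrite !mxE !big_ord1 !mxE; ring. Qed.

Lemma mem_plucker_index (i j : 'I_5) : (i < j)%N -> (i, j) \in plucker_index.
Proof.
by case: i => [[|[|[|[|[|?]]]]] // ?]; case: j => [[|[|[|[|[|?]]]]] // ?].
Qed.

(** The ten Pluecker coordinates are the entries above the diagonal, so they
determine an alternating matrix; this transfers equations between bivectors to
equations between matrices. *)
Lemma wedge_altmx u v (X : 'M[F]_5) (y : 'rV[F]_10) :
    (forall k, let: (i, j) := tnth plucker_index k in y 0 k = X i j) ->
    (forall i, X i i = 0) -> (forall i j, X i j = - X j i) ->
  y = wedge u v -> X = altmx u v.
Proof.
move=> yX X0 XC yE.
have up (i j : 'I_5) : (i < j)%N -> X i j = altmx u v i j.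
  move=> /mem_plucker_index/tnthP[k ijk].
  by move: (yX k); rewrite -ijk => <-; rewrite altmxE yE !mxE -ijk.
apply/matrixP => i j; case: (ltngtP i j) => [/up//|ji|/val_inj->].
  by rewrite XC up // !altmxE; ring.
by rewrite X0 altmxE; ring.
Qed.

Lemma altmx_inj a b c d : wedge a b = wedge c d -> altmx a b = altmx c d.
Proof.
apply: wedge_altmx => [k|i|i j]; rewrite ?altmxE; try ring.
by case E: (tnth _ k) => [i j]; rewrite mxE E altmxE.
Qed.

Lemma altmxD_inj a b c d e f :
  wedge a b + wedge c d = wedge e f -> altmx a b + altmx c d = altmx e f.
Proof.
apply: wedge_altmx => [k|i|i j].
- case E: (tnth _ k) => [i j].
  by rewrite [RHS]mxE !altmxE 3!mxE E.
- by rewrite mxE !altmxE; ring.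
by rewrite [LHS]mxE [in RHS]mxE !altmxE; ring.
Qed.

Definition symplectic_mx : 'M[F]_(1 + 1) := block_mx 0 1%:M (- 1%:M) 0.

Lemma altmx_congr u v : altmx u v = (col_mx u v)^T *m symplectic_mx *m col_mx u
    v.
Proof.
rewrite tr_col_mx mul_row_block mul_row_col !mulmx0 add0r addr0 mulmxN !mulmx1.
by rewrite mulNmx /altmx addrC.
Qed.

Lemma rank_symplectic_mx : \rank symplectic_mx = 2%N.
Proof.
apply/eqP/row_freeP; exists (block_mx 0 (- 1%:M) 1%:M 0).
rewrite mulmx_block !(mul0mx, mulmx0, mulNmx, mulmxN, mulmx1, opprK, addr0,
  add0r).
by rewrite -scalar_mx_block.
Qed.

Lemma altmx_sub u v : (altmx u v <= u + v)%MS.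
Proof. by rewrite altmx_congr addsmxE submxMl. Qed.

Lemma rank_adds_rV u v : (\rank (u + v)%MS <= 2)%N.
Proof. by rewrite addsmxE; apply: (leq_trans (rank_leq_row _)). Qed.

Lemma rank_altmx u v : \rank (u + v)%MS = 2%N -> \rank (altmx u v) = 2%N.
Proof.
by rewrite addsmxE altmx_congr => r; rewrite rank_congr ?rank_symplectic_mx //
  /row_free r.
Qed.

Lemma altmx_eq0 a b : wedge a b = 0 -> altmx a b = 0.
Proof.
rewrite -(wedgevv 0) => /altmx_inj ->.
by rewrite /altmx !mulmx0 subrr.
Qed.

Lemma wedge_eq0 a b : a != 0 -> (wedge a b == 0) = (b <= a)%MS.
Proof.
move=> a0; apply/eqP/idP => [w0|/sub_rVP[s ->]]; last first.
  by rewrite linearZ /= wedgevv scaler0.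
apply: contraT => /adds_not_sub; rewrite rank_rV a0 => /rank_altmx.
by rewrite altmx_eq0 // mxrank0.
Qed.

Lemma wedge_neq0P a b : wedge a b != 0 -> [/\ a != 0, b != 0 & ~~ (b <= a)%MS].
Proof.
move=> w0; have a0 : a != 0.
  by apply: contraNneq w0 => ->; rewrite wedgeC linear0 oppr0.
split=> //; first by apply: contraNneq w0 => ->; rewrite linear0.
by rewrite -wedge_eq0.
Qed.

Lemma rank_line a b : wedge a b != 0 -> \rank (a + b)%MS = 2%N.
Proof. by case/wedge_neq0P=> a0 _ /adds_not_sub->; rewrite rank_rV a0. Qed.

Lemma wedge_neq0E a b : (wedge a b != 0) = (\rank (a + b)%MS == 2%N).
Proof.
apply/idP/eqP => [|/rank_altmx r]; first exact: rank_line.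
by apply: contra_eq_neq r => w0; rewrite altmx_eq0 // mxrank0.
Qed.

(** A line is recovered from its bivector as the row space of the matrix. *)
Lemma altmx_line a b : wedge a b != 0 -> (altmx a b :=: a + b)%MS.
Proof.
move=> ab0; apply/eqmxP.
by rewrite -(mxrank_leqif_eq (altmx_sub a b)) rank_altmx rank_line.
Qed.

Lemma sub_line a b x :
  reflect (exists s t, x = s *: a + t *: b) (x <= a + b)%MS.
Proof.
apply: (iffP sub_addsmxP) => [[[s t] /= ->]|[s [t ->]]].
  by exists (s 0 0), (t 0 0); rewrite -!mul_scalar_mx -!mx11_scalar.
by exists (s%:M, t%:M); rewrite !mul_scalar_mx.
Qed.

(** Incidence of a point and a line: a /\ b lies in v /\ V exactly when the line
ab passes through v. *)
Lemma sub_pencil a b v : v != 0 -> wedge a b != 0 ->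
  (wedge a b <= pencil v)%MS = (v <= a + b)%MS.
Proof.
move=> v0 ab0; apply/pencilP/idP => [[x E]|/sub_line[s [t Ev]]].
  rewrite -(altmx_line ab0) (altmx_inj E) altmx_line; first exact: addsmxSl.
  by rewrite -E.
have [s0|s0] := eqVneq s 0.
  have t0 : t != 0.
    by apply: contraNneq v0 => t0; rewrite Ev s0 t0 !scale0r addr0.
  exists (- t^-1 *: a); rewrite Ev s0 scale0r add0r wedgeZl linearZ /= scalerA.
  have -> : t * - t^-1 = -1 by field.
  by rewrite scaleN1r -wedgeC.
exists (s^-1 *: b).
by rewrite Ev wedgeDl !wedgeZl !linearZ /= wedgevv !scaler0 addr0 scalerA mulVf
  // scale1r.
Qed.

(** If a, b, v, x were independent, a /\ b + v /\ x would have an alternating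
matrix congruent to the nondegenerate form on a space of rank 4, whereas e /\ f
has one of rank at most 2. *)
Lemma wedgeD_sub a b v x e f : wedge a b != 0 -> ~~ (v <= a + b)%MS ->
  wedge a b + wedge v x = wedge e f -> (x <= a + b + v)%MS.
Proof.
move=> ab0 nv E; apply: contraT => /adds_not_sub;
  rewrite (adds_not_sub nv) rank_line //.
move=> r4; have := rank_adds_rV e f.
suff r : \rank (altmx e f) = 4%N.
  by move/(leq_trans (mxrankS (altmx_sub e f))); rewrite r.
rewrite -(altmxD_inj E) !altmx_congr.
set M1 := col_mx a b; set M2 := col_mx v x.
have -> : M1^T *m symplectic_mx *m M1 + M2^T *m symplectic_mx *m M2 =
    (col_mx M1 M2)^T *m block_mx symplectic_mx 0 0 symplectic_mx *m col_mx M1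
      M2.
  by rewrite tr_col_mx mul_row_block mul_row_col !mulmx0 addr0 add0r.
rewrite rank_congr; first by rewrite rank_diag_block_mx rank_symplectic_mx.
by rewrite /row_free -addsmxE -(adds_eqmx (addsmxE _ _) (addsmxE _ _)) addsmxA
  r4.
Qed.

(** The line ef is the row space of its matrix, which is the sum of two matrices
with rows in the lines ab and vx. *)
Lemma line_sub_wedgeD a b v x e f : wedge e f != 0 ->
  wedge a b + wedge v x = wedge e f -> (e <= a + b + (v + x))%MS.
Proof.
move=> ef0 E; apply: submx_trans (addsmxSl e f) _.
rewrite -(altmx_line ef0) -(altmxD_inj E).
by rewrite addmx_sub // (submx_trans (altmx_sub _ _)) ?addsmxSl ?addsmxSr.
Qed.

(** The kernel of wedging with v is spanned by v. *)
Lemma rank_mul_pencil m (H : 'M[F]_(m, 5)) v : v != 0 -> (v <= H)%MS ->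
  \rank H = (\rank (H *m pencil v)).+1.
Proof.
move=> v0 vH; rewrite -(mxrank_mul_ker H (pencil v)) -[RHS]addn1;
  congr (_ + _)%N.
have r1 : \rank v = 1%N by rewrite rank_rV v0.
rewrite -[RHS]r1; apply: eqmx_rank; rewrite sub_capmx vH andbC; apply/andP;
  split.
  by apply/sub_kermxP; rewrite mul_pencil wedgevv.
apply/row_subP => i; rewrite -wedge_eq0 // -mul_pencil.
apply/eqP/sub_kermxP; exact: submx_trans (row_sub _ _) (capmxSr _ _).
Qed.

Lemma rank_pencil v : v != 0 -> \rank (pencil v) = 4%N.
Proof.
by move=> v0; have := rank_mul_pencil v0 (submx1 v);
  rewrite mxrank1 mul1mx => -[].
Qed.

Lemma wedge_line_sub a b x y :
  (x <= a + b)%MS -> (y <= a + b)%MS -> (wedge x y <= wedge a b)%MS.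
Proof.
move=> /sub_line[s [t ->]] /sub_line[s' [t' ->]].
rewrite wedgeDl !wedgeZl !linearD !linearZ /= !wedgevv !scaler0 add0r addr0.
by rewrite (wedgeC b a) addmx_sub ?scalemx_sub ?eqmx_opp.
Qed.

(** Two distinct points lie on only one common line. *)
Lemma cap_pencil u w : wedge u w != 0 ->
  (pencil u :&: pencil w <= wedge u w)%MS.
Proof.
move=> uw0; have [u0 w0 nwu] := wedge_neq0P uw0.
apply/row_subP => i; set y := row i _.
have : (y <= pencil u :&: pencil w)%MS by exact: row_sub.
rewrite sub_capmx => /andP[/pencilP[x ->] yw].
have [->|ux0] := eqVneq (wedge u x) 0; first exact: sub0mx.
move: yw; rewrite sub_pencil // => /sub_line[s [t wE]].
have t0 : t != 0.
  by apply: contraNneq nwu => t0; rewrite wE t0 scale0r addr0 scalemx_sub.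
by rewrite wE linearD !linearZ /= wedgevv scaler0 add0r (eqmx_scale _ t0).
Qed.

End Wedge.

(** * Numbers of decomposable bivectors *)

Section Counting.
Variable F : finFieldType.
Let q := #|F|.

Lemma q_gt1 : (1 < q)%N. Proof. exact: card_finNzRing_gt1. Qed.

Lemma card_rowg_nz m n (A : 'M[F]_(m, n)) :
  #|rowg A :\ 0| = (q ^ \rank A - 1)%N.
Proof.
by rewrite -card_rowg (cardsD1 0 (rowg A)) mem_rowg sub0mx add1n subn1.
Qed.

Definition decomposable : {set 'rV[F]_10} :=
  [set wedge u v | u : 'rV[F]_5, v : 'rV[F]_5].

Lemma decomposableP y :
  reflect (exists u v, y = wedge u v) (y \in decomposable).
Proof.
by apply: (iffP imset2P) => [[u v _ _ ->]|[u [v ->]]];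
  [exists u, v | exists u v].
Qed.

Lemma decomposable0 : 0 \in decomposable.
Proof. by apply/decomposableP; exists 0, 0; rewrite wedgevv. Qed.

Lemma decomposableZ s y : y \in decomposable -> s *: y \in decomposable.
Proof.
case/decomposableP=> [u [v ->]]; apply/decomposableP.
by exists (s *: u), v; rewrite wedgeZl.
Qed.

(** The cone over the set of points of G(2,5) in the subspace W; it contains 0. *)
Definition decomposables m (W : 'M[F]_(m, 10)) : {set 'rV[F]_10} :=
  decomposable :&: rowg W.

Definition wedges m (H : 'M[F]_(m, 5)) : {set 'rV[F]_10} :=
  [set wedge u v | u in rowg H, v in rowg H].

(** A line in H through the point v is v /\ x with x on that line, hence x is
itself in H. *)
Lemma wedges_pencil m (H : 'M[F]_(m, 5)) v : v != 0 ->
  wedges H :&: rowg (pencil v) \subset rowg (H *m pencil v).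
Proof.
move=> v0; apply/subsetP => y /setIP[/imset2P[a b aH bH ->]].
move: aH bH; rewrite !mem_rowg => aH bH vab.
have [->|ab0] := eqVneq (wedge a b) 0; first exact: sub0mx.
have [x E] := pencilP _ _ vab; rewrite E -mul_pencil submxMr //.
have abH : (a + b <= H)%MS by rewrite addsmx_sub aH.
apply: submx_trans abH; have vx0 : wedge v x != 0 by rewrite -E.
have [_ x0 _] := wedge_neq0P vx0.
by rewrite -sub_pencil // E wedgeC eqmx_opp wedge_pencil.
Qed.

(** Incidences between the nonzero vectors v of H and the nonzero bivectors y of
lines in H are counted twice: each v lies on q^h - 1 of the y, and each y has
q^2 - 1 vectors on its line. *)
Lemma card_wedges m (H : 'M[F]_(m, 5)) h : \rank H = h.+1 ->
  ((q ^ h.+1 - 1) * (q ^ h - 1) = #|wedges H :\ 0%R| * (q ^ 2 - 1))%N.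
Proof.
move=> rH; rewrite -{1}rH -card_rowg_nz.
apply: (double_count_const (R := fun v y => (y <= H *m pencil v)%MS)) => [v|y].
  move=> /setD1P[v0]; rewrite mem_rowg => vH.
  have [->] : h.+1 = (\rank (H *m pencil v)).+1
      by rewrite -rH (rank_mul_pencil v0).
  rewrite -card_rowg_nz; apply: eq_card => y; rewrite !inE.
  case: eqP => //= _; apply: andb_idl => /submxP[z ->].
  apply/imset2P; exists v (z *m H); rewrite ?inE ?submxMl //.
  by rewrite mulmxA mul_pencil.
case/setD1P=> y0 yH; have /imset2P[a b aH bH Ey] := yH.
rewrite Ey in y0; rewrite -[X in (_ ^ X - _)%N](rank_line y0) -card_rowg_nz.
apply: eq_card => v; rewrite !inE; have [//|v0] /= := eqVneq v 0.
rewrite -(sub_pencil v0 y0) -Ey; move: aH bH; rewrite !mem_rowg => aH bH.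
apply/andP/idP => [[_ le]|yv]; first exact: submx_trans le (submxMl _ _).
split; last first.
  by rewrite -mem_rowg (subsetP (wedges_pencil H v0)) // inE yH mem_rowg.
move: yv; rewrite Ey sub_pencil // => /submx_trans; apply.
by rewrite addsmx_sub aH.
Qed.

Lemma card_decomposable :
  (#|decomposable :\ 0%R| =
   (q - 1) * (q ^ 6 + q ^ 5 + 2 * q ^ 4 + 2 * q ^ 3 + 2 * q ^ 2 + q + 1))%N.
Proof.
have -> : decomposable = wedges (1%:M : 'M[F]_5).
  apply/setP => y; apply/decomposableP/imset2P => [[u [v ->]]|[u v _ _ ->]];
    last by exists u, v.
  by exists u v; rewrite ?inE ?submx1.
have := card_wedges (mxrank1 F 5).
rewrite exp4_sub1; have := q_gt1; case E: q => [|[|p]] // _.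
have -> : (p.+2 ^ 5 - 1 = p.+1 * (p.+2 ^ 4 + p.+2 ^ 3 + p.+2 ^ 2 + p.+2 + 1))%N.
  by rewrite -[RHS](addnK 1%N); congr (_ - _)%N; lia.
have p0 : (0 < p.+2 ^ 2 - 1)%N by rewrite subn_gt0.
rewrite mulnA => /eqP; rewrite eqn_pmul2r // => /eqP <-.
by rewrite subn1 /=; lia.
Qed.

Lemma card_wedges4 m (H : 'M[F]_(m, 5)) : \rank H = 4%N ->
  (#|wedges H :\ 0%R| = q ^ 5 + q ^ 3 - q ^ 2 - 1)%N.
Proof.
move/card_wedges; rewrite exp4_sub1; have := q_gt1; case E: q => [|[|p]] // _.
have p0 : (0 < p.+2 ^ 2 - 1)%N by rewrite subn_gt0.
rewrite mulnAC => /eqP; rewrite eqn_pmul2r // => /eqP <-.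
by rewrite mulnBr !mulnDl !mul1n muln1 -expnD subnDA.
Qed.

End Counting.

(** * The points of a line *)

Section LinePoints.
Variables (F : fieldType) (u w : 'rV[F]_5).
Hypothesis uw0 : wedge u w != 0.

(** The q + 1 points of the line uw, the index [None] standing for the point at
infinity w of the parametrization u + c w. *)
Definition line_point (i : option F) : 'rV[F]_5 :=
  if i is Some c then u + c *: w else w.

Lemma line_point_sub i : (line_point i <= u + w)%MS.
Proof.
case: i => [c|] /=; last exact: addsmxSr.
by rewrite addmx_sub ?addsmxSl // scalemx_sub ?addsmxSr.
Qed.

Lemma wedge_line_points i j : i != j ->
  exists2 s, s != 0 & wedge (line_point i) (line_point j) = s *: wedge u w.
Proof.
case: i j => [c|] [d|] //= ne; last 2 first.
- exists 1; first exact: oner_neq0.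
  by rewrite wedgeDl wedgeZl wedgevv scaler0 addr0 scale1r.
- exists (- 1); first by rewrite oppr_eq0 oner_neq0.
  by rewrite linearD linearZ /= wedgevv scaler0 addr0 scaleN1r wedgeC.
exists (d - c); first by rewrite subr_eq0 eq_sym.
rewrite linearD linearZ /= !wedgeDl !wedgeZl !wedgevv scaler0 addr0 add0r.
by rewrite (wedgeC w u) scalerN -scaleNr -scalerDl addrC.
Qed.

Lemma line_point_neq0 i : line_point i != 0.
Proof.
pose j : option F := if i is Some _ then None else Some 0.
have /wedge_line_points[s s0 E] : i != j by rewrite {}/j; case: i.
have : wedge (line_point i) (line_point j) != 0.
  by rewrite E scaler_eq0 negb_or s0.
by case/wedge_neq0P.
Qed.

Lemma line_in_pencil i : (wedge u w <= pencil (line_point i))%MS.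
Proof. by rewrite sub_pencil ?line_point_neq0 // line_point_sub. Qed.

Lemma pencil_scale s (v : 'rV[F]_5) : (pencil (s *: v) <= pencil v)%MS.
Proof.
apply/row_subP => i; rewrite rowE mul_pencil wedgeZl scalemx_sub //.
exact: wedge_pencil.
Qed.

Lemma line_pointP v : v != 0 -> (v <= u + w)%MS ->
  exists i, (pencil v <= pencil (line_point i))%MS.
Proof.
move=> v0 /sub_line[s [t E]]; have [s0|s0] := eqVneq s 0.
  by exists None; rewrite E s0 scale0r add0r pencil_scale.
exists (Some (t / s)).
have -> : v = s *: line_point (Some (t / s)).
  by rewrite E /= scalerDr scalerA mulrC divfK.
exact: pencil_scale.
Qed.

Lemma pencil_line_point i : (pencil (line_point i) <= pencil u + pencil w)%MS.
Proof.
case: i => [c|] /=; last exact: addsmxSr.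
apply/row_subP => i; rewrite rowE mul_pencil wedgeDl wedgeZl addmx_sub //.
  exact: submx_trans (wedge_pencil _ _) (addsmxSl _ _).
by rewrite scalemx_sub // (submx_trans (wedge_pencil _ _)) ?addsmxSr.
Qed.

(** Either hypothesis says that a, b, u, w are dependent, that is, that the lines
ab and uw have a common point. *)
Lemma meeting_line a b : wedge a b != 0 ->
    (u <= a + b)%MS || (w <= a + b + u)%MS ->
  exists i, (wedge a b <= pencil (line_point i))%MS.
Proof.
move=> ab0 uw; have [u0 _ nwu] := wedge_neq0P uw0.
have meet (v : 'rV[F]_5) : v != 0 -> (v <= u + w)%MS -> (v <= a + b)%MS ->
    exists i, (wedge a b <= pencil (line_point i))%MS.
  move=> v0 vuw; rewrite -(sub_pencil v0 ab0) => vab.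
  by have [i vi] := line_pointP v0 vuw; exists i; apply: submx_trans vab vi.
have [/(meet _ u0)|nu] /= := boolP (u <= a + b)%MS; first by apply;
    rewrite addsmxSl.
move: uw; rewrite (negPf nu) /= => /sub_addsmxP[[s t] /= E].
apply: (meet (w - t *m u)).
- by rewrite subr_eq0; apply: contraNneq nwu => ->; rewrite submxMl.
- by rewrite addmx_sub ?addsmxSr // eqmx_opp mulmx_sub ?addsmxSl.
by rewrite E addrK submxMl.
Qed.

(** The cosets of <u /\ w> separate the lines skew to uw. *)
Lemma skew_line_wedgeD a b c e f : wedge a b != 0 ->
    (forall i, ~~ (wedge a b <= pencil (line_point i))%MS) ->
  wedge a b + c *: wedge u w = wedge e f -> c = 0.
Proof.
move=> ab0 nab; rewrite -linearZ /= => E.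
apply/eqP/contraT => c0.
have [i] : exists i, (wedge a b <= pencil (line_point i))%MS.
  apply: meeting_line => //; have [//|nu /=] := boolP (u <= a + b)%MS.
  by rewrite -(eqmx_scale _ c0) (wedgeD_sub ab0 nu E).
by rewrite (negPf (nab i)).
Qed.

(** A decomposable vector of the tangent space u /\ V + w /\ V of the
Grassmannian at the line uw is a line that meets uw: the equation
a /\ b - u /\ x = w /\ z puts x, and then w, into the span of a, b, u. *)
Lemma tangent_line a b : wedge a b != 0 ->
    (wedge a b <= pencil u + pencil w)%MS ->
  exists i, (wedge a b <= pencil (line_point i))%MS.
Proof.
move=> ab0 /sub_addsmxP[[x z] /=]; rewrite !mul_pencil => E.
apply: meeting_line => //; have [//|nu /=] := boolP (u <= a + b)%MS.
have {}E : wedge a b + wedge u (- x) = wedge w z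
    by rewrite E linearN /= addrAC subrr add0r.
have xabu := wedgeD_sub ab0 nu E.
have wz0 : wedge w z != 0.
  have [u0 _ _] := wedge_neq0P uw0.
  apply: contra nu; rewrite -(sub_pencil u0 ab0) -E linearN subr_eq0.
  by move/eqP->; apply: wedge_pencil.
apply: submx_trans (line_sub_wedgeD wz0 E) _.
by rewrite addsmx_sub addsmxSl addsmx_sub addsmxSr xabu.
Qed.

End LinePoints.

(** * Upper bounds for linear sections *)

(** The index i runs over the q + 1 points of a line p in W, [b i] is the rank of
the part of W in the pencil at i, and s + 1 is the rank of the part of W in
the tangent space at p.  If i is a point with the largest [b i], the others
are at most both [b i] and s + 2 - b i, which leaves one numerical
inequality for each value of [b i]. *)
Lemma sum_line_bound (I : finType) (b : I -> nat) q s :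
    (1 < q)%N -> #|I| = q.+1 ->
    (forall i, 0 < b i <= 3)%N -> (forall i, b i <= s.+1)%N ->
    (forall i j, i != j -> b i + b j <= s.+2)%N ->
  (\sum_i (q ^ b i - q) + q ^ 2 + q <= q ^ 3 + q ^ s)%N.
Proof.
move=> q1 cI b13 bs bb.
have /card_gt0P[i0 _] : (0 < #|I|)%N by rewrite cI.
case: (@arg_maxnP _ i0 xpredT b isT) => i _ imax.
have bound c : (forall j, j != i -> b j <= c)%N ->
    (\sum_i (q ^ b i - q) <= q ^ b i - q + q * (q ^ c - q))%N.
  move=> bc; rewrite (bigD1 i) //= leq_add2l.
  apply: (@leq_trans (\sum_(j | j != i) (q ^ c - q))).
    by apply: leq_sum => j /bc; rewrite -(leq_exp2l _ _ q1); lia.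
  by rewrite sum_nat_const cardC1 cI.
have c1 : (forall j, j != i -> b j <= b i)%N by move=> j _; apply: imax.
have c2 : (forall j, j != i -> b j <= s.+2 - b i)%N.
  by move=> j /bb; lia.
move: (bound _ c1) (bound _ c2) (b13 i) (bs i).
move: (\sum_i _)%N => S.
have q2 : (q <= q ^ 2)%N by nia.
have q3 : (2 * q ^ 2 <= q ^ 3)%N by nia.
have qle k : (k <= s)%N -> (q ^ k <= q ^ s)%N by rewrite leq_exp2l.
(* [b1] uses the bound b j <= b i, and [b2] the bound b j <= s + 2 - b i. *)
case: (b i) => [|[|[|[|?]]]] //= b1 b2 _ bs'.
- by have := qle 0%N (leq0n s); rewrite expn0; nia.
- have [s2|/qle] := ltnP s 2; last by nia.
  have s1 : s = 1%N by lia.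
  by move: b2; rewrite s1 expn1 /= subnn; nia.
have [s4|/qle] := ltnP s 4.
  have /orP[/eqP s2|/eqP s3] : (s == 2)%N || (s == 3)%N by lia.
    by move: b2; rewrite s2 expn1 /= subnn; nia.
  by move: b2; rewrite s3 -[(3.+2 - 3)%N]/2%N mulnBr -expnS mulnn; lia.
have q4 : (q ^ 2 <= q ^ 4)%N by rewrite leq_exp2l.
by move: b1; rewrite mulnBr -expnS mulnn; lia.
Qed.

Section Bound.
Variable F : finFieldType.
Let q := #|F|.

(** Modulo the pencil, W has q^k - 1 nonzero classes, and each contains at most
q^2 decomposable vectors: if y0 = a /\ b is one of them, the others differ from
it by v /\ x with x in the span of a, b, v, that is, by an element of
v /\ <a, b>. *)
Lemma card_decomposables_pencil m (W : 'M[F]_(m, 10)) v k :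
    v != 0 -> (pencil v <= W)%MS -> \rank W = (k + 4)%N ->
  (#|decomposables W| + q ^ 2 <= q ^ 4 + q ^ (k + 2))%N.
Proof.
move=> v0 vW rW; rewrite -(cardsID (rowg (pencil v)) (decomposables W)).
have in1 : (#|decomposables W :&: rowg (pencil v)| <= q ^ 4)%N.
  by rewrite -[X in (_ <= _ ^ X)%N](rank_pencil v0) -card_rowg subset_leq_card
    // subsetIr.
set C := cokermx (pencil v); set S := decomposables W :\: _.
have rWC : \rank (W *m C) = k.
  have := mxrank_mul_ker W C.
  suff -> : \rank (W :&: kermx C) = 4%N by rewrite rW => /addIn.
  rewrite -[RHS](rank_pencil v0); apply/eqmx_rank.
  rewrite sub_capmx vW andbC; apply/andP; split.
    by apply/sub_kermxP; rewrite mulmx_coker.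
  apply/row_subP => i; rewrite submxE -/C; apply/eqP/sub_kermxP.
  exact: submx_trans (row_sub _ _) (capmxSr _ _).
have in2 : (#|S| <= (q ^ k - 1) * q ^ 2)%N.
  rewrite -rWC -card_rowg_nz; apply: (@leq_card_fibre _ _ _ _ (mulmxr C)) =>
    [y|z].
    rewrite !inE /= => /andP[yv /andP[_ yW]].
    by rewrite submxMr // andbT -submxE.
  set Z := [set y in S | _].
  have [->|[y0]] := set_0Vmem Z; first by rewrite cards0.
  rewrite !inE /= => /andP[/andP[y0v /andP[/decomposableP[a [b Ey]] y0W]] /eqP
    y0C].
  have ab0 : wedge a b != 0 by rewrite -Ey; apply: contraNneq y0v => ->;
      rewrite sub0mx.
  have nv : ~~ (v <= a + b)%MS by rewrite -sub_pencil // -Ey.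
  rewrite -[X in (_ <= _ ^ X)%N](rank_line ab0).
  apply: (@leq_trans (#|F| ^ \rank ((a + b)%MS *m pencil v))); last first.
    by rewrite leq_exp2l ?q_gt1 // mxrankM_maxl.
  rewrite -card_rowg -(card_imset (mem (rowg ((a + b)%MS *m pencil v))) (addrI
    y0)).
  apply: subset_leq_card; apply/subsetP => y; rewrite !inE /=.
  move=> /andP[/andP[yv /andP[/decomposableP[e [f Ef]] yW]] /eqP yC].
  have : (y - y0 <= pencil v)%MS by rewrite submxE -/C mulmxBl yC y0C subrr.
  case/pencilP=> x Ex; apply/imsetP; exists (y - y0);
    last by rewrite addrC subrK.
  rewrite !inE Ex.
  have : (x <= a + b + v)%MS.
    by apply: (@wedgeD_sub _ a b v x e f) => //; rewrite -Ex -Ef Ey addrC subrK.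
  case/sub_addsmxP => -[s t] /= ->.
  rewrite linearD /= [t]mx11_scalar mul_scalar_mx linearZ /= wedgevv scaler0
    addr0.
  by rewrite -mul_pencil submxMr // submxMl.
have q2 : (0 < q ^ k)%N by rewrite expn_gt0 ltnW ?q_gt1.
have -> : (q ^ (k + 2) = (q ^ k - 1) * q ^ 2 + q ^ 2)%N by rewrite expnD; nia.
by rewrite addnA leq_add2r leq_add.
Qed.

Variables (m k : nat) (W : 'M[F]_(m, 10)).
Hypothesis rW : \rank W = k.+1.

(** With p = u /\ w, the decomposable vectors of W split into those in the union
U of the pencils at the points of p, which share <p>, and the lines skew to p.
The latter number at most q^k - q^s, because (y, c) |-> y + c p embeds the
skew lines times F into the complement in W of the tangent space T. *)
Lemma card_decomposables_line u w :
    wedge u w != 0 -> (wedge u w <= W)%MS ->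
    (forall v, v != 0 -> ~~ (pencil v <= W)%MS) ->
  (#|decomposables W| + q ^ 2 <= q ^ k + q ^ 3)%N.
Proof.
move=> uw0 uwW noP; have q1 : (1 < q)%N := q_gt1 F.
have rp : \rank (wedge u w) = 1%N by rewrite rank_rV uw0.
have rank_gt0 (A : 'M[F]_10) : (wedge u w <= A)%MS -> (0 < \rank A)%N.
  by move/mxrankS; rewrite rp.
pose B i := (pencil (line_point u w i) :&: W)%MS.
pose T := ((pencil u + pencil w) :&: W)%MS.
have BT i : (B i <= T)%MS by rewrite capmxS // pencil_line_point.
have pB i : (wedge u w <= B i)%MS by rewrite sub_capmx uwW line_in_pencil.
have pT : (wedge u w <= T)%MS := submx_trans (pB None) (BT None).
have [s rT] : exists s, \rank T = s.+1.
  by exists (\rank T).-1; rewrite prednK // rank_gt0.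
have b_gt0 i : (0 < \rank (B i))%N by exact: rank_gt0 (pB i).
have b_le3 i : (\rank (B i) <= 3)%N.
  rewrite -ltnS -[X in (_ < X)%N](rank_pencil (line_point_neq0 uw0 i)).
  apply: rank_ltmx; rewrite /ltmx capmxSl sub_capmx submx_refl /=.
  exact/noP/line_point_neq0.
have b_leT i : (\rank (B i) <= s.+1)%N by rewrite -rT mxrankS.
have b_pair i j : i != j -> (\rank (B i) + \rank (B j) <= s.+2)%N.
  move=> ij; rewrite -mxrank_sum_cap -[X in (_ <= X)%N]addn1 leq_add //.
    by rewrite -rT mxrankS // addsmx_sub !BT.
  have [c c0 E] := wedge_line_points u w ij.
  rewrite -[X in (_ <= X)%N]rp mxrankS //.
  apply: submx_trans (capmxS (capmxSl _ _) (capmxSl _ _)) _.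
  have ij0 : wedge (line_point u w i) (line_point u w j) != 0.
    by rewrite E scaler_eq0 negb_or c0.
  by apply: submx_trans (cap_pencil ij0) _; rewrite E scalemx_sub.
have b13 i : (0 < \rank (B i) <= 3)%N by rewrite b_gt0 b_le3.
have sumB := sum_line_bound q1 (card_option F) b13 b_leT b_pair.
pose U := \bigcup_i rowg (B i).
have cardU : (#|decomposables W :&: U| <= q + \sum_i (q ^ \rank (B i) - q))%N.
  apply: (@leq_trans #|rowg (wedge u w) :|: \bigcup_i (rowg (B i) :\: rowg
    (wedge u w))|).
    apply: subset_leq_card; apply/subsetP => y /setIP[_ /bigcupP[i _ yB]].
    rewrite in_setU; have [//|yp] /= := boolP (y \in rowg _).
    by apply/bigcupP; exists i => //; rewrite in_setD yp.
  apply: leq_trans (leq_card_setU _ _) _.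
  rewrite card_rowg rp expn1 leq_add2l; apply: leq_trans (leq_card_bigcup _) _.
  apply: leq_sum => i _; rewrite cardsD (setIidPr _) ?rowgS //.
  by rewrite !card_rowg rp expn1.
have cardD : (#|decomposables W :\: U| * q <= q ^ k.+1 - q ^ s.+1)%N.
  have <- : #|rowg W :\: rowg T| = (q ^ k.+1 - q ^ s.+1)%N.
    by rewrite cardsD (setIidPr _) ?rowgS ?capmxSr // !card_rowg rW rT.
  have <- : #|setX (decomposables W :\: U) [set: F]| =
      (#|decomposables W :\: U| * q)%N.
    by rewrite cardsX cardsT.
  have skew y : y \in decomposables W :\: U ->
      exists a b, [/\ y = wedge a b, wedge a b != 0
      & forall i, ~~ (wedge a b <= pencil (line_point u w i))%MS].
    case/setDP=> /setIP[/decomposableP[a [b ->]] abW] abU; exists a, b.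
    have abB i : ~~ (wedge a b <= pencil (line_point u w i))%MS.
      apply: contra abU => abi; apply/bigcupP; exists i => //.
      by rewrite mem_rowg sub_capmx abi -mem_rowg.
    split=> //; apply: contraNneq (abB None) => ->; exact: sub0mx.
  pose f (yc : 'rV[F]_10 * F) := yc.1 + yc.2 *: wedge u w.
  rewrite -(card_in_imset (f := f)).
    apply: subset_leq_card; apply/subsetP => _ /imsetP[[y c] /setXP[/= yD _]
      ->].
    have [a [b [Ey ab0 abB]]] := skew y yD.
    have yW : (y <= W)%MS by case/setDP: yD => /setIP[_]; rewrite mem_rowg.
    rewrite in_setD !mem_rowg /f /=; apply/andP; split;
      last by rewrite addmx_sub ?scalemx_sub.
    apply/negP => yT; have {yT} : (y <= T)%MS.
      by rewrite -(addrK (c *: wedge u w) y) addmx_sub // eqmx_opp scalemx_sub.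
    rewrite sub_capmx Ey => /andP[/(tangent_line uw0 ab0)[i abi] _].
    by case/negP: (abB i).
  move=> [y c] [z d] /setXP[/= yD _] /setXP[/= zD _]; rewrite /f /= => E.
  have [a [b [Ey ab0 abB]]] := skew y yD.
  have /setDP[/setIP[/decomposableP[e [g Ez]] _] _] := zD.
  have cd : c - d = 0.
    apply: (skew_line_wedgeD uw0 ab0 abB (e := e) (f := g)).
    by rewrite -Ey -Ez scalerBl addrA E addrK.
  by move/eqP: cd E; rewrite subr_eq0 => /eqP-> /addIr->.
have {}cardD : (#|decomposables W :\: U| + q ^ s <= q ^ k)%N.
  have sk : (q ^ s <= q ^ k)%N.
    by rewrite leq_exp2l // -ltnS -rT -rW mxrankS // capmxSr.
  move: cardD; rewrite !expnS -mulnBr mulnC leq_pmul2l ?(ltnW q1) //.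
  by rewrite leq_subRL // addnC.
rewrite -(cardsID U (decomposables W)); move: sumB cardU cardD => /=.
move: (\sum_i _)%N => S; lia.
Qed.

Lemma card_decomposables_bound : (4 <= k <= 5)%N ->
    (#|decomposables W| + q ^ 2 <= q ^ k + q ^ 3)%N.
Proof.
move=> k45; have q1 : (1 < q)%N := q_gt1 F.
have [/existsP[v /andP[v0 vW]]|/existsPn noP] :=
    boolP [exists v : 'rV[F]_5, (v != 0) && (pencil v <= W)%MS].
  apply: (leq_trans (card_decomposables_pencil (k := k - 3) v0 vW _));
    first by rewrite rW; lia.
  have /orP[/eqP->|/eqP->] : (k == 4)%N || (k == 5)%N by lia.
    by [].
  rewrite -[(5 - 3 + 2)%N]/4%N expnS -/q addnn -mul2n.
  by apply: leq_trans (leq_addr _ _); rewrite leq_mul2r q1 orbT.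
have [/existsP[u /existsP[w /andP[uw0 uwW]]]|/existsPn no] :=
    boolP [exists u, exists w, (wedge u w != 0) && (wedge u w <= W)%MS].
  apply: card_decomposables_line uw0 uwW _ => v v0.
  by have := noP v; rewrite v0.
have -> : decomposables W = [set 0].
  apply/setP => y; rewrite inE mem_rowg in_set1; apply/andP/eqP => [[]|->];
    last first.
    by rewrite sub0mx decomposable0.
  move/decomposableP=> [u [w ->]] uwW; apply/eqP;
    move/existsPn: (no u) => /(_ w).
  by rewrite uwW andbT negbK.
rewrite cards1 addnC; apply: leq_add; first by rewrite leq_exp2l //; lia.
by rewrite expn_gt0 (ltnW q1).
Qed.

End Bound.

(** * Extremal linear sections *)

Section Examples.
Variable F : finFieldType.
Let q := #|F|.
Implicit Types a b v x y : 'rV[F]_5.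

Lemma card_decomposables_rank4 v : v != 0 ->
    #|decomposables (pencil v)| = (q ^ 4)%N.
Proof.
move=> v0; rewrite /q -[X in (_ ^ X)%N](rank_pencil v0) -card_rowg;
  congr #|pred_of_set _|.
apply/setIidPr/subsetP => y; rewrite mem_rowg => /pencilP[x ->].
by apply/decomposableP; exists v, x.
Qed.

(** Besides the q^4 vectors of the pencil, the space contains the q^3 bivectors of
the plane abv, all of them decomposable; the two families share only the
q^2 vectors of v /\ <a, b>. *)
Lemma card_decomposables_rank5 a b v : wedge a b != 0 -> ~~ (v <= a + b)%MS ->
  \rank (pencil v + wedge a b)%MS = 5%N /\
  (q ^ 4 + q ^ 3 <= #|decomposables (pencil v + wedge a b)%MS| + q ^ 2)%N.
Proof.
move=> ab0 nv.
have v0 : v != 0 by apply: contraNneq nv => ->; rewrite sub0mx.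
split; first by rewrite adds_not_sub ?rank_pencil // sub_pencil.
pose H := (a + b + v)%MS.
have rH : \rank H = 3%N by rewrite adds_not_sub // rank_line.
have vH : (v <= H)%MS by rewrite addsmxSr.
have q1 : (1 < q)%N := q_gt1 F.
have cH : (#|wedges H| = q ^ 3)%N.
  have := card_wedges rH => /eqP; rewrite eqn_pmul2r; last first.
    by rewrite subn_gt0 -/q -[X in (X < _)%N](expn0 q) ltn_exp2l.
  move/eqP=> E; rewrite (cardsD1 0) -E.
  have -> : (0 \in wedges H) by apply/imset2P; exists 0 0;
      rewrite ?mem_rowg ?sub0mx ?wedgevv.
  by rewrite subnKC // expn_gt0 (ltnW q1).
have cI : (#|decomposables (pencil v) :&: wedges H| <= q ^ 2)%N.
  have [r2] : 3%N = (\rank (H *m pencil v)).+1 by rewrite -rank_mul_pencil.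
  rewrite /q [X in (_ ^ X)%N]r2 -card_rowg; apply: subset_leq_card.
  apply: subset_trans (wedges_pencil H v0); rewrite setIC.
  by apply: setIS; apply: subsetIr.
rewrite -(card_decomposables_rank4 v0) -cH -cardsUI leq_add //.
apply/subset_leq_card/subsetP => y /setUP[/setIP[yd yv]|/imset2P[x z xH zH ->]].
  by rewrite inE yd mem_rowg (submx_trans _ (addsmxSl _ _)) // -mem_rowg.
rewrite !mem_rowg in xH zH; apply/setIP; split.
  by apply/decomposableP; exists x, z.
rewrite mem_rowg; case/sub_addsmxP: xH => -[s t] /= ->;
  case/sub_addsmxP: zH => -[s' t'] /= ->.
rewrite [t]mx11_scalar [t']mx11_scalar !mul_scalar_mx.
rewrite wedgeDl linearD /= -addrA addmx_sub //.
  by apply: submx_trans (addsmxSr _ _); apply: wedge_line_sub; exact: submxMl.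
apply: submx_trans (addsmxSl _ _).
rewrite addmx_sub //; last by rewrite wedgeZl scalemx_sub // wedge_pencil.
by rewrite linearZ /= wedgeC scalerN eqmx_opp scalemx_sub // wedge_pencil.
Qed.

(** The four Pluecker coordinates killed here are those that involve the first
coordinate of V, so the subspace consists of the bivectors of the hyperplane
where that coordinate vanishes. *)
Lemma card_decomposables_rank6 :
  (q ^ 5 + q ^ 3 <= #|decomposables (copid_mx 4 : 'M[F]_10)| + q ^ 2)%N.
Proof.
have r4 : \rank (copid_mx 1 : 'M[F]_5) = 4%N by rewrite rank_copid_mx.
have := card_wedges4 r4; set H := copid_mx 1.
have q1 : (1 < q)%N := q_gt1 F.
have : (#|wedges H :\ 0%R| < #|decomposables (copid_mx 4 : 'M[F]_10)|)%N.
  apply: proper_card; rewrite properE; apply/andP; split.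
    apply/subsetP => y /setD1P[_ /imset2P[u v uH vH ->]].
    apply/setIP; split; first by apply/decomposableP; exists u, v.
    move: uH vH; rewrite !mem_rowg !sub_copid // => /forallP/(_ 0)/= /eqP u0
      /forallP/(_ 0)/= /eqP v0.
    apply/forallP => k; apply/implyP => k4; rewrite mxE.
    have : (tnth plucker_index k).1 = 0.
      by case: k k4 => [[|[|[|[|?]]]] ?].
    by case: (tnth _ k) => i j /= ->; rewrite u0 v0 mul0r mulr0 subrr.
  apply/subsetPn; exists 0; last by rewrite setD11.
  by apply/setIP; rewrite mem_rowg sub0mx decomposable0.
rewrite -/q => lt E; move: lt; rewrite {}E.
have : (q ^ 2 <= q ^ 5)%N by rewrite leq_exp2l.
move: #|_|; lia.
Qed.

End Examples.

(** * Higher weights *)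

Lemma plucker_wedge (F : fieldType) (A : 'M[F]_(2, 5)) :
  (plucker A)^T = wedge (row 0 A) (row 1 A).
Proof.
by apply/rowP => k; rewrite !mxE; case: (tnth _ k) => i j; rewrite !mxE.
Qed.

Lemma row_free_wedge (F : fieldType) (A : 'M[F]_(2, 5)) :
  row_free A = (wedge (row 0 A) (row 1 A) != 0).
Proof.
rewrite wedge_neq0E /row_free; congr (_ == _); apply: eqmx_rank.
rewrite addsmx_sub !row_sub !andbT; apply/row_subP => i.
have [-> | ->] : i = 0 \/ i = 1.
  by case: i => [[|[|//]]] ?; [left | right]; apply: val_inj.
- exact: addsmxSl.
- exact: addsmxSr.
Qed.

Lemma wedge_plucker (F : fieldType) (u v : 'rV[F]_5) : wedge u v != 0 ->
  exists2 A : 'M[F]_(2, 5), row_free A & (plucker A)^T = wedge u v.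
Proof.
move=> uv0; exists (\matrix_i (if i == 0 then u else v)).
  by rewrite row_free_wedge !rowK.
by rewrite plucker_wedge !rowK.
Qed.

Section Code.
Variables (F : finFieldType) (N : nat) (G : 'M[F]_(10, N)).
Hypothesis hG : grassmann_generator G.
Let q := #|F|.

Definition columns_in m (W : 'M[F]_(m, 10)) : {set 'I_N} :=
  [set j | ((col j G)^T <= W)%MS].

Lemma column_decomposable j :
  (col j G)^T \in decomposable F /\ (col j G)^T != 0.
Proof.
have [A fA [c c0 ->]] := hG.1 j; rewrite linearZ /= plucker_wedge; split.
  by apply/decomposableZ/decomposableP; exists (row 0 A), (row 1 A).
by rewrite scaler_eq0 negb_or c0 -row_free_wedge.
Qed.

(** Nonzero decomposable vectors, up to scalars, correspond to the columns of the
generator matrix. *)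
Lemma decomposable_column y : y \in decomposable F -> y != 0 ->
  exists j, forall j', (exists c, y = c *: (col j' G)^T) <-> j' = j.
Proof.
case/decomposableP=> u [v ->] uv0; have [A fA Ey] := wedge_plucker uv0.
have [j [[c c0 Ej] uj]] := hG.2 A fA; exists j => j'; split=> [[d E]|->].
  apply/esym/uj; have d0 : d != 0.
    by apply: contraNneq uv0 => d0; rewrite E d0 scale0r.
  exists d^-1; rewrite ?invr_eq0 //; apply: (can_inj (@trmxK _ _ _)).
  by rewrite linearZ /= Ey E scalerA mulVf // scale1r.
by exists c^-1; rewrite Ej linearZ /= Ey scalerA mulVf // scale1r.
Qed.

(** Each column accounts for its q - 1 nonzero multiples, and the summand 1
for the zero vector. *)
Lemma card_decomposables_columns m (W : 'M[F]_(m, 10)) :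
  #|decomposables W| = (#|columns_in W| * (q - 1) + 1)%N.
Proof.
rewrite (cardsD1 0%R) inE decomposable0 mem_rowg sub0mx addnC; congr (_ + _)%N.
rewrite -[LHS]muln1; apply/esym.
pose R j y := [exists c, y == c *: (col j G)^T].
apply: (double_count_const (R := R)) => [j|y].
  rewrite inE => jW; have [jd j0] := column_decomposable j.
  have <- : #|[set: F] :\ 0| = (q - 1)%N.
    by rewrite /q -cardsT (cardsD1 0 setT) in_setT add1n subn1.
  have inj : injective (fun c : F => c *: (col j G)^T).
    move=> c d /eqP; rewrite -subr_eq0 -scalerBl scaler_eq0 (negPf j0) orbF.
    by rewrite subr_eq0 => /eqP.
  rewrite -(card_imset _ inj); apply: eq_card => y; rewrite [LHS]inE.
  apply/andP/imsetP => [[/setD1P[y0 _] /existsP[c /eqP Ey]]|[c /setD1P[c0 _]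
    ->]].
    exists c => //; rewrite in_setD1 in_setT andbT.
    by apply: contraNneq y0 => c0; rewrite Ey c0 scale0r.
  split; last by apply/existsP; exists c.
  rewrite in_setD1 scaler_eq0 negb_or c0 j0 inE decomposableZ //.
  by rewrite mem_rowg scalemx_sub.
case/setD1P=> y0 /setIP[yd]; rewrite mem_rowg => yW.
have [j Hj] := decomposable_column yd y0.
rewrite -[RHS](cards1 j); apply: eq_card => j'; rewrite [LHS]inE in_set1.
apply/andP/eqP => [[_ /existsP[c /eqP E]]|->]; first by apply/Hj; exists c.
have [c E] := (Hj j).2 erefl.
split; last by apply/existsP; exists c; rewrite E.
have c0 : c != 0 by apply: contraNneq y0 => c0; rewrite E c0 scale0r.
by rewrite inE -(eqmx_scale _ c0) -E.
Qed.

Lemma card_columns :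
  N = (q ^ 6 + q ^ 5 + 2 * q ^ 4 + 2 * q ^ 3 + 2 * q ^ 2 + q + 1)%N.
Proof.
have q1 : (1 < q)%N := q_gt1 F.
have := card_decomposables_columns (1%:M : 'M_10).
have -> : columns_in 1%:M = [set: 'I_N] by apply/setP => j; rewrite !inE submx1.
have -> : decomposables (1%:M : 'M[F]_10) = decomposable F.
  by apply/setIidPl/subsetP => y _; rewrite mem_rowg submx1.
rewrite cardsT card_ord (cardsD1 0) decomposable0 addnC card_decomposable -/q.
by move/addIn; rewrite [RHS]mulnC => /eqP;
  rewrite eqn_pmul2l ?subn_gt0 // => /eqP <-.
Qed.

(** G(2,5) spans the projective space: every coordinate vector is the bivector of
a coordinate line. *)
Lemma row_free_generator : row_free G.
Proof.
apply: inj_row_free => z zG; apply/rowP => k; rewrite mxE.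
pose u : 'rV[F]_5 := delta_mx 0 (tnth plucker_index k).1.
pose v : 'rV[F]_5 := delta_mx 0 (tnth plucker_index k).2.
have uv : wedge u v = delta_mx 0 k.
  apply/rowP => l; rewrite !mxE {}/u {}/v.
  case: k => [[|[|[|[|[|[|[|[|[|[|?]]]]]]]]]] ?] //;
  case: l => [[|[|[|[|[|[|[|[|[|[|?]]]]]]]]]] ?] //; rewrite /= !mxE /=; ring.
have kd : (delta_mx 0 k : 'rV[F]_10) \in decomposable F.
  by apply/decomposableP; exists u, v.
have k0 : (delta_mx 0 k : 'rV[F]_10) != 0.
  by apply/eqP => /rowP/(_ k)/eqP; rewrite !mxE !eqxx oner_eq0.
have [l /(_ l)[_ /(_ erefl)[c Ek]]] := decomposable_column kd k0.
have : (z *m (delta_mx 0 k : 'rV[F]_10)^T) 0 0 = 0.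
  rewrite Ek linearZ /= trmxK -scalemxAr -col_mulmx zG.
  by rewrite !mxE mulr0.
by rewrite trmx_delta -colE mxE.
Qed.

(** A position is outside the support of the subcode of X *m G when the
corresponding column of G is annihilated by X. *)
Lemma code_supportE m (X : 'M[F]_(m, 10)) n (D : 'M[F]_(n, N)) :
    (D :=: X *m G)%MS ->
  code_support D = ~: columns_in (kermx X^T).
Proof.
move=> DX; apply/setP => j; rewrite !inE.
have -> : ((col j G)^T <= kermx X^T)%MS = (X *m col j G == 0).
  rewrite -(inj_eq (@trmx_inj _ _ _)) trmx_mul trmx0.
  exact/sub_kermxP/eqP.
rewrite -col_mulmx; apply/existsP/idP => [[v]|].
  rewrite DX => /andP[/submxP[z ->]]; apply: contra => /eqP c0.
  have -> : (z *m (X *m G)) 0 j = col j (z *m (X *m G)) 0 0 by rewrite [RHS]mxE.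
  by rewrite col_mulmx c0 mulmx0 mxE.
case/matrix0Pn=> i [j0]; rewrite mxE => ij.
by exists (row i (X *m G)); rewrite DX row_sub mxE.
Qed.

(** Subcodes of rank r correspond to subspaces W of rank 10 - r by
annihilation, and the support of a subcode consists of the columns of G
outside W. *)
Lemma higher_weight_columns r c : (r <= 10)%N ->
    (forall W : 'M[F]_10, \rank W = (10 - r)%N -> #|columns_in W| <= c)%N ->
    (exists2 W : 'M[F]_10, \rank W = (10 - r)%N & c <= #|columns_in W|)%N ->
  higher_weight G r = (N - c)%N.
Proof.
move=> r10 up [W rW cW]; rewrite /higher_weight.
have fG := row_free_generator.
apply/eqP; rewrite eqn_leq; apply/andP; split.
  pose X := (cokermx W)^T.
  have rX : \rank (X *m G) = r.
    by rewrite mxrankMfree // mxrank_tr mxrank_coker rW subKn.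
  have gX : (<<X *m G>> <= G)%MS && (\rank <<X *m G>>%MS == r).
    by rewrite genmxE submxMl mxrank_gen rX eqxx.
  apply: (@leq_trans #|code_support <<X *m G>>%MS|).
    have := @Order.TotalTheory.bigmin_le_cond _ _ _ N <<X *m G>>%MS
      (fun D : 'M_N => (D <= G)%MS && (\rank D == r))
      (fun D => #|code_support D|) gX.
    by rewrite Order.NatOrder.minEnat leEnat.
  rewrite (code_supportE (genmxE _)) cardsCs setCK card_ord leq_sub2l //.
  apply: (leq_trans cW); apply/subset_leq_card/subsetP => j.
  by rewrite !inE submxE trmxK => /eqP/sub_kermxP.
elim/big_ind: _ => [|x y|D /andP[/submxP[X ->] /eqP rD]]; first exact: leq_subr.
  by rewrite leq_min => -> ->.
rewrite (code_supportE (eqmx_refl _)) cardsCs setCK card_ord leq_sub2l //.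
by apply: up; rewrite mxrank_ker mxrank_tr -rD mxrankMfree.
Qed.

Lemma higher_weight_decomposables r c : (r <= 10)%N ->
    (forall W : 'M[F]_10, \rank W = (10 - r)%N ->
      #|decomposables W| <= c * (q - 1) + 1)%N ->
    (exists2 W : 'M[F]_10, \rank W = (10 - r)%N &
      c * (q - 1) + 1 <= #|decomposables W|)%N ->
  higher_weight G r = (N - c)%N.
Proof.
move=> r10 up low; have q1 : (0 < q - 1)%N by rewrite subn_gt0 q_gt1.
apply: higher_weight_columns => // [W /up|].
  by rewrite card_decomposables_columns leq_add2r leq_pmul2r.
by have [W rW] := low; rewrite card_decomposables_columns leq_add2r leq_pmul2r
  // => ?; exists W.
Qed.

Lemma decomposables_eqmx m n (V : 'M[F]_(m, 10)) (W : 'M[F]_(n, 10)) :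
  (V :=: W)%MS -> decomposables V = decomposables W.
Proof. by move=> VW; apply/setP => y; rewrite !in_setI !mem_rowg VW. Qed.

Lemma higher_weight_4 : higher_weight G 4 =
    (N - (q ^ 4 + q ^ 3 + 2 * q ^ 2 + q + 1))%N.
Proof.
have q1 : (1 < q)%N := q_gt1 F.
have e : ((q ^ 4 + q ^ 3 + 2 * q ^ 2 + q + 1) * (q - 1) + 1 + q ^ 2 =
    q ^ 5 + q ^ 3)%N.
  by move: q q1 => [//|p _]; rewrite subn1 /=; lia.
apply: higher_weight_decomposables => // [W rW|].
  by rewrite -(leq_add2r (q ^ 2)) e (card_decomposables_bound rW).
exists (copid_mx 4); first by rewrite rank_copid_mx.
by rewrite -(leq_add2r (q ^ 2)) e card_decomposables_rank6.
Qed.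

Lemma higher_weight_5 : higher_weight G 5 = (N - (q ^ 3 + 2 * q ^ 2 + q + 1))%N.
Proof.
have q1 : (1 < q)%N := q_gt1 F.
have e : ((q ^ 3 + 2 * q ^ 2 + q + 1) * (q - 1) + 1 + q ^ 2 = q ^ 4 + q ^ 3)%N.
  by move: q q1 => [//|p _]; rewrite subn1 /=; lia.
apply: higher_weight_decomposables => // [W rW|].
  by rewrite -(leq_add2r (q ^ 2)) e (card_decomposables_bound rW).
pose d (i : 'I_5) : 'rV[F]_5 := delta_mx 0 i.
have n12 : ~~ (d 2 <= d 1)%MS.
  by apply/negP => /sub_rVP[s /rowP/(_ 2)/eqP]; rewrite !mxE /= mulr0 oner_eq0.
have d1 : d 1 != 0 by apply/eqP => /rowP/(_ 1)/eqP; rewrite !mxE /= oner_eq0.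
have n012 : ~~ (d 0 <= d 1 + d 2)%MS.
  by apply/negP => /sub_line[s [t /rowP/(_ 0)/eqP]];
    rewrite !mxE /= !mulr0 addr0 oner_eq0.
have w12 : wedge (d 1) (d 2) != 0 by rewrite wedge_eq0.
have [r5 c5] := card_decomposables_rank5 w12 n012.
exists (pencil (d 0) + wedge (d 1) (d 2))%MS => //.
by rewrite -(leq_add2r (q ^ 2)) e.
Qed.

Lemma higher_weight_6 : higher_weight G 6 = (N - (q ^ 3 + q ^ 2 + q + 1))%N.
Proof.
have q1 : (1 < q)%N := q_gt1 F.
have e : ((q ^ 3 + q ^ 2 + q + 1) * (q - 1) + 1 = q ^ 4)%N.
  by move: q q1 => [//|p _]; rewrite subn1 /=; lia.
apply: higher_weight_decomposables => // [W rW|].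
  by rewrite e /q -[X in (_ <= _ ^ X)%N]rW -card_rowg subset_leq_card //
    subsetIr.
have d0 : (delta_mx 0 0 : 'rV[F]_5) != 0.
  by apply/eqP => /rowP/(_ 0)/eqP; rewrite !mxE /= oner_eq0.
exists <<pencil (delta_mx 0 0 : 'rV[F]_5)>>%MS;
  first by rewrite mxrank_gen rank_pencil.
by rewrite (decomposables_eqmx (genmxE _)) e card_decomposables_rank4.
Qed.

End Code.

Local Close Scope ring_scope.

Theorem proposition4p6 (F : finFieldType) (N : nat) (G : 'M[F]_(10, N))
    (hG : grassmann_generator G) :
  let q := #|F| in
  let n := q ^ 6 + q ^ 5 + 2 * q ^ 4 + 2 * q ^ 3 + 2 * q ^ 2 + q + 1 in
  let d := higher_weight G in
  [/\ d 5 = n - (q ^ 3 + 2 * q ^ 2 + q + 1),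
      d 5 = d 4 + q ^ 4
    & d 5 = d 6 - q ^ 2].
Proof.
move=> q n d; rewrite /d (higher_weight_4 hG) (higher_weight_5 hG)
  (higher_weight_6 hG).
by rewrite (card_columns hG) -/q -/n; split=> //; rewrite /n; lia.
Qed.
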